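(* Let $A_1=P_1J_1P_1^{-1}$ with $J_1=\begin{pmatrix}-n_1&1\\0&-n_1\end{pmatrix}$, $n_1>0$, and $A_2=P_2J_2P_2^{-1}$ with $J_2=\begin{pmatrix}\alpha_2&\beta_2\\-\beta_2&\alpha_2\end{pmatrix}$, $\alpha_2>0$, $\beta_2\ne0$; here $P_1,P_2$ are real invertible $2\times 2$ matrices chosen such that $M=P_2^{-1}P_1=\begin{pmatrix}a&b\\c&d\end{pmatrix}$ has determinant $1$ or $-1$. Given $\eta>0$, let $\tau_{1,2}(\eta)$ be the unique positive solution $t$ of $$n_1t-\ln\theta(t)=\alpha_2\eta+\sinh^{-1}\sqrt{\frac14\left(a^2+c^2+\frac1{a^2+c^2}\right)^2-1}.$$ Then the switched system $\dot x(t)=A_{\sigma(t)}x(t)$ is stable for all $\sigma\in\mathcal S[\tau_{1,2}(\eta),\eta]$ and asymptotically stable for all $\sigma\in\mathcal S'[\tau_{1,2}(\eta),\eta]$.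
   Context: $\theta(t)=\left\|\begin{pmatrix}1&t\\0&1\end{pmatrix}\right\|=\sqrt{1+\frac{t^2}{2}+t\sqrt{1+\frac{t^2}{4}}}$ (spectral norm). Planar switched system: $\dot x(t)=A_{\sigma(t)}x(t)$, $x(t)\in\mathbb R^2$ continuous in $t\ge0$, with $A_1,A_2$ real $2\times2$ matrices. A switching signal $\sigma:[0,\infty)\to\{1,2\}$ is right-continuous and piecewise constant with infinitely many discontinuities $0<d_1<d_2<\cdots$, $d_k\to\infty$; set $d_0=0$. For a signal with $\sigma(0)=1$ put $t_k=d_{2k-1}-d_{2k-2}$ (times spent in $A_1$) and $s_k=d_{2k}-d_{2k-1}$ (times spent in $A_2$), $k\ge1$. For $\tau,\eta>0$, $\mathcal S[\tau,\eta]$ is the set of signals with $\sigma(0)=1$, $t_k\ge\tau$ and $s_k\le\eta$ for all $k\in\mathbb N$; $\mathcal S'[\tau,\eta]$ is the set of $\sigma\in\mathcal S[\tau,\eta]$ for which the sequence $(t_k,s_k)_{k\ge1}$ does not converge to $(\tau,\eta)$. For a given signal $\sigma$, the system is stable if for every $\varepsilon'>0$ there is $\delta>0$ such that $\|x(0)\|<\delta$ implies $\|x(t)\|<\varepsilon'$ for all $t>0$; it is asymptotically stable if it is stable and $\|x(t)\|\to0$ as $t\to\infty$ for every $x(0)\in\mathbb R^2$. Vector norms are Euclidean. *)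

(* Defs.v *)
From mathcomp Require Import all_boot all_order all_algebra.
From mathcomp Require Import all_classical all_reals all_analysis.
From mathcomp Require Import ring lra.

Set Implicit Arguments.
Unset Strict Implicit.
Unset Printing Implicit Defensive.

Import Order.TTheory GRing.Theory Num.Theory.
Import numFieldNormedType.Exports.

Local Open Scope classical_set_scope.
Local Open Scope ring_scope.

Definition mx2 (R : realType) (a b c d : R) : 'M[R]_2 :=
  \matrix_(i < 2, j < 2)
    if i == 0 then (if j == 0 then a else b) else (if j == 0 then c else d).

(* The library norm on matrices is the sup norm, hence a separate Euclidean
   norm. *)
Definition enorm (R : realType) (n : nat) (x : 'cV[R]_n) : R :=
  Num.sqrt (\sum_(i < n) x i 0 ^+ 2).

Definition spectral_norm (R : realType) (A : 'M[R]_2) : R :=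
  sup [set enorm (A *m x) | x in [set x : 'cV[R]_2 | enorm x = 1]].

Definition theta (R : realType) (t : R) : R := spectral_norm (mx2 1 t 0 1).

Definition sinh (R : realType) (x : R) : R := (expR x - expR (- x)) / 2.

Definition arsinh (R : realType) (y : R) : R := ln (y + Num.sqrt (y ^+ 2 + 1)).

Lemma arsinhK (R : realType) : cancel (@arsinh R) (@sinh R).
Proof.
move=> y; rewrite /sinh /arsinh expRN.
set r := Num.sqrt _.
have r2 : r ^+ 2 = y ^+ 2 + 1 by rewrite sqr_sqrtr//; have := sqr_ge0 y; lra.
have r0 : 0 <= r by exact: sqrtr_ge0.
have yr : 0 < y + r by nra.
rewrite lnK ?posrE//.
have -> : (y + r)^-1 = r - y.
  by apply: (mulfI (lt0r_neq0 yr)); rewrite divff ?lt0r_neq0//; nra.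
by field.
Qed.

Lemma sinhK (R : realType) : cancel (@sinh R) (@arsinh R).
Proof.
move=> x; rewrite /sinh /arsinh expRN.
have e0 := expR_gt0 x.
have -> : ((expR x - (expR x)^-1) / 2) ^+ 2 + 1 =
          ((expR x + (expR x)^-1) / 2) ^+ 2 by field; exact: lt0r_neq0.
rewrite sqrtr_sqr ger0_norm; last first.
  by rewrite divr_ge0// addr_ge0 ?invr_ge0// ltW.
have -> : (expR x - (expR x)^-1) / 2 + (expR x + (expR x)^-1) / 2 = expR x.
  by field; exact: lt0r_neq0.
by rewrite expRK.
Qed.

Variant mode := Mode1 | Mode2.

(* d 0 = 0 and d 1 < d 2 < ... are exactly the discontinuities of sigma on
   [0, +oo[; constancy on the half-open intervals [d k, d k.+1[ is
   right-continuity together with piecewise constancy.  Values of sigma at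
   negative times are irrelevant. *)
Definition switching_times (R : realType) (sigma : R -> mode) (d : nat -> R) :
    Prop :=
  [/\ d 0%N = 0,
      (forall k, d k < d k.+1),
      d k @[k --> \oo] --> +oo,
      (forall k t, d k <= t < d k.+1 -> sigma t = sigma (d k)) &
      (forall k, sigma (d k.+1) <> sigma (d k))].

(* Indices are shifted: these are t_{k+1} and s_{k+1}. *)
Definition stay1 (R : realType) (d : nat -> R) (k : nat) : R :=
  d k.*2.+1 - d k.*2.
Definition stay2 (R : realType) (d : nat -> R) (k : nat) : R :=
  d k.*2.+2 - d k.*2.+1.

Definition dwell_switching (R : realType) (tau eta : R) (sigma : R -> mode)
    (d : nat -> R) : Prop :=
  [/\ switching_times sigma d,
      sigma 0 = Mode1 &
      forall k, tau <= stay1 d k /\ stay2 d k <= eta].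

Definition signals (R : realType) (tau eta : R) : set (R -> mode) :=
  [set sigma | exists d, dwell_switching tau eta sigma d].

(* The sequence d is determined by sigma, so the existential quantifier is
   harmless. *)
Definition signals' (R : realType) (tau eta : R) : set (R -> mode) :=
  [set sigma | exists d, dwell_switching tau eta sigma d /\
    ~ ((stay1 d k, stay2 d k) @[k --> \oo] --> (tau, eta))].

Definition subsystem (R : realType) (A1 A2 : 'M[R]_2) (m : mode) : 'M[R]_2 :=
  match m with Mode1 => A1 | Mode2 => A2 end.

(* Only the restriction of x to [0, +oo[ matters.  The differential equation is
   imposed at all t > 0 around which sigma is locally constant, i.e. away from
   the switching times. *)
Definition solution (R : realType) (A1 A2 : 'M[R]_2) (sigma : R -> mode)
    (x : R -> 'cV[R]_2) : Prop :=
  {within `[0, +oo[, continuous x} /\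
  forall t : R, 0 < t -> (\forall s \near t, sigma s = sigma t) ->
    is_derive t 1 x (subsystem A1 A2 (sigma t) *m x t).

Definition stable (R : realType) (A1 A2 : 'M[R]_2) (sigma : R -> mode) : Prop :=
  forall eps : R, 0 < eps -> exists2 delta : R, 0 < delta &
    forall x, solution A1 A2 sigma x -> enorm (x 0) < delta ->
      forall t : R, 0 < t -> enorm (x t) < eps.

Definition asymptotically_stable (R : realType) (A1 A2 : 'M[R]_2)
    (sigma : R -> mode) : Prop :=
  stable A1 A2 sigma /\
  forall x, solution A1 A2 sigma x -> enorm (x t) @[t --> +oo] --> (0 : R).

(* Main.v *)
Require Import Defs.
From mathcomp Require Import all_boot all_order all_algebra.
From mathcomp Require Import all_classical all_reals all_analysis.
From mathcomp Require Import ring lra.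

Set Implicit Arguments.
Unset Strict Implicit.
Unset Printing Implicit Defensive.

Import Order.TTheory GRing.Theory Num.Theory.
Import numFieldNormedType.Exports.

Local Open Scope classical_set_scope.
Local Open Scope ring_scope.

(** The energy V(x) = |P2^-1 x|^2 is followed over one cycle, that is, a stay of
    length t in the first subsystem and then one of length s in the second.

    In the basis P2 the second subsystem is a rotation with exponential growth,
    so it multiplies V by exactly expR (2 alpha2 s) (focus_flow).  For the first
    one, the basis P1 may be sheared freely, since shears commute with the Jordan
    block; the good shear makes the columns of the transition matrix orthogonal,
    of lengths sqrt u and 1 / sqrt u with u = a^2 + c^2.  The change of basis and
    its inverse then cost the condition number mu = max (u, 1 / u), and the flow
    costs expR (- n1 t) theta t, so V is multiplied by at most
    (mu expR (- n1 t) theta t)^2 (mode1_phase).  The arsinh term of the equation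
    for tau is ln mu (arsinh_condition), so that equation says that the two
    factors balance at (t, s) = (tau, eta).

    The substitution t = 2 sinh v gives ln (theta t) = v (theta_sinh).  The gain
    n1 t - ln (theta t) thus becomes 2 n1 sinh v - v, a convex function that
    vanishes at 0: it takes every positive value exactly once, and from tau on it
    grows at least at a linear rate r > 0 (dwell_gain_growth).  A cycle with
    t >= tau and s <= eta therefore multiplies V by at most expR (- e), where
    e = 2 (r (t - tau) + alpha2 (eta - s)) >= 0, and V stays within a fixed
    multiple of its initial value inside the cycle (dwell_cycle).  This gives
    stability.  When (t_k, s_k) does not tend to (tau, eta), the numbers e_k do not
    tend to 0; being nonnegative, they have a divergent sum, and V tends to 0
    (cycle_cvg0). *)

(** * Euclidean norm and spectral norm of a shear *)

Lemma enormE (R : realType) (x : 'cV[R]_2) :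
  enorm x ^+ 2 = x 0 0 ^+ 2 + x 1 0 ^+ 2.
Proof.
rewrite sqr_sqrtr; last by apply: sumr_ge0 => i _; exact: sqr_ge0.
by rewrite big_ord_recl big_ord1; congr (_ + x _ _ ^+ _); apply: val_inj.
Qed.

Lemma enorm_ge0 (R : realType) (x : 'cV[R]_2) : 0 <= enorm x.
Proof. exact: sqrtr_ge0. Qed.

Lemma mulmx2E (R : realType) (M : 'M[R]_2) (x : 'cV[R]_2) i :
  (M *m x) i 0 = M i 0 * x 0 0 + M i 1 * x 1 0.
Proof.
rewrite mxE big_ord_recl big_ord1.
by congr (_ + M i _ * x _ _); apply: val_inj.
Qed.

Lemma mx2E (R : realType) (a b c d : R) :
  ((mx2 a b c d 0 0 = a) * (mx2 a b c d 0 1 = b) *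
   (mx2 a b c d 1 0 = c) * (mx2 a b c d 1 1 = d))%type.
Proof. by rewrite !mxE. Qed.

Lemma det_mx2 (R : realType) (a b c d : R) : \det (mx2 a b c d) = a * d - b * c.
Proof.
rewrite (expand_det_row _ 0) big_ord_recl big_ord1 /cofactor !det_mx11 !mxE /=.
by rewrite expr0 expr1; ring.
Qed.

Lemma col_norm_gt0 (R : realType) (a b c d : R) :
  (a * d - b * c) ^+ 2 = 1 -> 0 < a ^+ 2 + c ^+ 2.
Proof.
move=> det1; rewrite lt_def addr_ge0 ?sqr_ge0// andbT; apply/eqP => u0.
have [a0 c0] : a = 0 /\ c = 0 by split; nra.
move: det1; rewrite a0 c0 mul0r mulr0 subrr expr0n => /eqP.
by rewrite eq_sym oner_eq0.
Qed.

(** By Cauchy-Schwarz, with the squared Frobenius norm plus 1 as constant: the 1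
    makes the constant positive even when M vanishes. *)
Lemma mulmx_enorm_le (R : realType) (M : 'M[R]_2) :
  exists2 C, 0 < C & forall x, enorm (M *m x) ^+ 2 <= C * enorm x ^+ 2.
Proof.
exists (1 + M 0 0 ^+ 2 + M 0 1 ^+ 2 + M 1 0 ^+ 2 + M 1 1 ^+ 2).
  by rewrite !ltr_wpDr ?sqr_ge0.
move=> x; rewrite !enormE !mulmx2E -subr_ge0.
set x0 := x 0 0; set x1 := x 1 0; set m00 := M 0 0; set m01 := M 0 1.
set m10 := M 1 0; set m11 := M 1 1.
rewrite (_ : _ - _ = x0 ^+ 2 + x1 ^+ 2 + (m00 * x1 - m01 * x0) ^+ 2 +
  (m10 * x1 - m11 * x0) ^+ 2); last by ring.
by rewrite !addr_ge0 ?sqr_ge0.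
Qed.

(** Energies in a fixed basis are equivalent to the Euclidean norm. *)
Lemma enorm_le_energy (R : realType) (P : 'M[R]_2) : P \in unitmx ->
  exists2 C, 0 < C & forall x, enorm x ^+ 2 <= C * enorm (invmx P *m x) ^+ 2.
Proof.
move=> uP; have [C C0 hC] := mulmx_enorm_le P; exists C => // x.
by have := hC (invmx P *m x); rewrite mulmxA mulmxV// mul1mx.
Qed.

(** With p = expR v, p - p^-1 is 2 * sinh v: the difference of the two sides is
    a single square, so p is the exact norm of the shear and the maximum is
    reached where x1 = x2 / p. *)
Lemma shear_norm_le (R : realType) (p x1 x2 : R) : 1 <= p ->
  (x1 + (p - p^-1) * x2) ^+ 2 + x2 ^+ 2 <= p ^+ 2 * (x1 ^+ 2 + x2 ^+ 2).
Proof.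
move=> p1; have p0 : p != 0 by rewrite gt_eqF// (lt_le_trans _ p1).
rewrite -subr_ge0.
rewrite (_ : _ - _ = (p ^+ 2 - 1) * (x1 - x2 / p) ^+ 2); last by field.
by rewrite mulr_ge0 ?sqr_ge0// subr_ge0 expr_ge1// ltW// (lt_le_trans ltr01).
Qed.

(** The substitution t = 2 * sinh v that turns the spectral norm of the shear
    into an exponential; all later facts on theta go through it. *)
Lemma theta_sinh (R : realType) (v : R) : 0 <= v -> theta (2 * sinh v) = expR v.
Proof.
move=> v0; set p := expR v.
have p1 : 1 <= p by rewrite -expR0 ler_expR.
have p0 : p != 0 by rewrite gt_eqF// expR_gt0.
have pp : 0 <= p := expR_ge0 v.
have -> : 2 * sinh v = p - p^-1 by rewrite /sinh expRN -/p; field.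
have nE (x : 'cV[R]_2) : enorm (mx2 1 (p - p^-1) 0 1 *m x) ^+ 2 =
    (x 0 0 + (p - p^-1) * x 1 0) ^+ 2 + x 1 0 ^+ 2.
  by rewrite enormE !mulmx2E !mx2E !mul1r mul0r add0r.
have s0 : 0 < 1 + p ^+ 2 by rewrite ltr_wpDr// sqr_ge0.
pose x0 : 'cV[R]_2 :=
  \col_i ((if i == 0 then 1 else p) / Num.sqrt (1 + p ^+ 2)).
have x0E : (x0 0 0 ^+ 2 = 1 / (1 + p ^+ 2)) * (x0 1 0 = p * x0 0 0).
  rewrite !mxE /= expr_div_n sqr_sqrtr ?ltW// expr1n; split => //.
  by rewrite mulrA mulr1.
have ubp : ubound [set enorm (mx2 1 (p - p^-1) 0 1 *m x) |
    x in [set x : 'cV[R]_2 | enorm x = 1]] p.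
  move=> _ [x /= nx <-]; rewrite -(@ler_pXn2r _ 2%N)// ?nnegrE ?enorm_ge0// nE.
  by have := shear_norm_le (x 0 0) (x 1 0) p1; rewrite -enormE nx expr1n mulr1.
have memp : [set enorm (mx2 1 (p - p^-1) 0 1 *m x) |
    x in [set x : 'cV[R]_2 | enorm x = 1]] p.
  exists x0 => /=.
    apply/eqP; rewrite -(@eqrXn2 _ 2%N)// ?enorm_ge0// enormE !x0E exprMn !x0E.
    by apply/eqP; field; rewrite gt_eqF.
  apply/eqP; rewrite -(@eqrXn2 _ 2%N)// ?enorm_ge0// nE !x0E.
  rewrite (_ : _ + _ = (p ^+ 4 + p ^+ 2) * x0 0 0 ^+ 2); last by field.
  by rewrite !x0E; apply/eqP; field; rewrite gt_eqF.
apply/eqP; rewrite eq_le; apply/andP; split.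
  by apply: ge_sup => //; exists p.
by apply: ub_le_sup => //; exists p.
Qed.

(** * The scalar gain of the first subsystem *)

Definition cosh (R : realType) (x : R) : R := (expR x + expR (- x)) / 2.

Lemma is_derive_sinh (R : realType) (x : R) : is_derive x 1 (@sinh R) (cosh x).
Proof.
rewrite /sinh /cosh.
apply: is_derive_eq.
by rewrite /GRing.scale /=; ring.
Qed.

Lemma cosh_gt0 (R : realType) (x : R) : 0 < cosh x.
Proof. by rewrite /cosh divr_gt0// addr_gt0// expR_gt0. Qed.

Lemma cosh_le (R : realType) (x y : R) : 0 <= x -> x <= y -> cosh x <= cosh y.
Proof.
move=> x0 xy; rewrite /cosh !expRN.
have ex : 1 <= expR x by rewrite -expR0 ler_expR.
have exy : expR x <= expR y by rewrite ler_expR.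
have x0' := expR_gt0 x; have y0' := expR_gt0 y.
rewrite ler_pM2r ?invr_gt0// -subr_ge0.
rewrite (_ : _ - _ = (expR y - expR x) * (1 - (expR x * expR y)^-1)); last first.
  by field; rewrite !gt_eqF.
rewrite mulr_ge0 ?subr_ge0// invf_le1 ?mulr_gt0//.
by rewrite mulr_ege1// (le_trans ex).
Qed.

Lemma continuous_is_derive (R : realType) (f df : R -> R) :
  (forall t : R, is_derive t 1 f (df t)) -> continuous f.
Proof.
move=> fdf t; apply/differentiable_continuous/derivable1_diffP.
by apply: ex_derive; exact: fdf.
Qed.

(** Mean value theorem, cosh being nondecreasing on the half-line. *)
Lemma sinh_increment (R : realType) (x y : R) : 0 <= x -> x <= y ->
  cosh x * (y - x) <= sinh y - sinh x <= cosh y * (y - x).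
Proof.
move=> x0 xy.
have cs z : {for z, continuous (@sinh R)}.
  by apply/differentiable_continuous/derivable1_diffP; apply: ex_derive;
     exact: is_derive_sinh.
have [z _||c /itvP cxy ->] := @MVT_segment R (@sinh R) (@cosh R) x y xy.
- exact: is_derive_sinh.
- exact: continuous_subspaceT.
by apply/andP; split; apply: ler_wpM2r; rewrite ?subr_ge0//;
   apply: cosh_le; rewrite ?cxy// (le_trans x0)// cxy.
Qed.

Lemma sinh0 (R : realType) : sinh (0 : R) = 0.
Proof. by rewrite /sinh oppr0 subrr mul0r. Qed.

Lemma sinh_ge0 (R : realType) (x : R) : 0 <= x -> 0 <= sinh x.
Proof.
move=> x0; have /andP[+ _] := sinh_increment (lexx 0) x0.
by rewrite sinh0 !subr0; apply: le_trans; rewrite mulr_ge0// ltW// cosh_gt0.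
Qed.

Lemma double_sinh_param (R : realType) (t : R) :
  0 <= t -> exists2 v, 0 <= v & t = 2 * sinh v.
Proof.
move=> t0; exists (arsinh (t / 2)); last by rewrite arsinhK; field.
rewrite /arsinh ln_ge0// ler_wpDl ?divr_ge0// -[leLHS]sqrtr1 ler_wsqrtr//.
by rewrite lerDr sqr_ge0.
Qed.

Lemma theta_gt0 (R : realType) (t : R) : 0 <= t -> 0 < theta t.
Proof.
move=> t0; have [v v0 ->] := double_sinh_param t0.
by rewrite theta_sinh// expR_gt0.
Qed.

Lemma theta_le (R : realType) (t : R) : 0 <= t -> theta t <= 1 + t.
Proof.
move=> t0; have [v v0 ->] := double_sinh_param t0.
rewrite theta_sinh// /sinh.
have : expR (- v) <= 1 by rewrite -expR0 ler_expR oppr_le0.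
lra.
Qed.

Lemma shear_theta_le (R : realType) (t x1 x2 : R) : 0 <= t ->
  (x1 + t * x2) ^+ 2 + x2 ^+ 2 <= theta t ^+ 2 * (x1 ^+ 2 + x2 ^+ 2).
Proof.
move=> t0; have [v v0 ->] := double_sinh_param t0.
rewrite theta_sinh//.
have -> : 2 * sinh v = expR v - (expR v)^-1.
  by rewrite /sinh expRN; field; rewrite gt_eqF ?expR_gt0.
by apply: shear_norm_le; rewrite -expR0 ler_expR.
Qed.

(** In the variable v with t = 2 * sinh v, the gain n t - ln (theta t) reads
    2 n sinh v - v, which is convex and vanishes at 0.  Where it is positive its
    derivative in t, n - 1 / (2 cosh v), is therefore positive as well, and by
    convexity this slope persists beyond tau.  The linear rate is what makes
    every excess of dwell time over tau count. *)
Lemma dwell_gain_growth (R : realType) (n tau : R) :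
  0 < tau -> 0 < n * tau - ln (theta tau) ->
  exists2 c, 0 < c & forall t, tau <= t ->
    n * tau - ln (theta tau) + c * (t - tau) <= n * t - ln (theta t).
Proof.
move=> tau0; have [v v0 tv] := double_sinh_param (ltW tau0).
rewrite {}tv in tau0 *; rewrite theta_sinh// expRK => gv.
have sv : 0 < sinh v by rewrite -(@pmulr_rgt0 _ 2).
have /andP[_] := sinh_increment (lexx 0) v0; rewrite sinh0 !subr0 => svc.
have cv := cosh_gt0 v.
have vp : 0 < v.
  rewrite lt_def v0 andbT; apply/eqP => v0'.
  by move: sv; rewrite v0' sinh0 ltxx.
(* This is the positivity of the derivative at tau, up to a factor 2 cosh v. *)
have nc : 1 < n * (2 * cosh v) by nra.
exists (n - (2 * cosh v)^-1).
  by rewrite subr_gt0 -[ltLHS]mul1r ltr_pdivrMr// mulr_gt0.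
move=> t tt.
have [w w0 tw] := double_sinh_param (ltW (lt_le_trans tau0 tt)).
rewrite {}tw in tt *; rewrite theta_sinh// expRK.
have vw : v <= w.
  rewrite leNgt; apply/negP => wv.
  have /andP[+ _] := sinh_increment w0 (ltW wv).
  have := cosh_gt0 w; nra.
have /andP[+ _] := sinh_increment v0 vw.
rewrite mulrC -ler_pdivlMr// => h.
have -> : (n - (2 * cosh v)^-1) * (2 * sinh w - 2 * sinh v) =
  n * (2 * sinh w - 2 * sinh v) - (sinh w - sinh v) / cosh v.
  by field; rewrite gt_eqF.
lra.
Qed.

Lemma dwell_gain_inj (R : realType) (n s t : R) : 0 < s -> 0 < t ->
  0 < n * s - ln (theta s) -> n * s - ln (theta s) = n * t - ln (theta t) ->
  s = t.
Proof.
wlog st : s t / s <= t => [hw s0 t0 gs gst|s0 t0 gs gst].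
  case/orP: (le_total s t) => st; first exact: (hw s t st s0 t0 gs gst).
  by apply/esym/(hw t s st t0 s0 _ (esym gst)); rewrite -gst.
have [r r0 /(_ t st)] := dwell_gain_growth s0 gs.
rewrite -{}gst; set g := (_ - ln _).
rewrite -lerBrDl subrr pmulr_rle0// subr_le0 => ts.
by apply/eqP; rewrite eq_le st.
Qed.

(** Intermediate value theorem in the variable v, where 2 n sinh v - v is
    continuous, vanishes at 0 and is unbounded. *)
Lemma dwell_gain_surjective (R : realType) (n C : R) : 0 < n -> 0 < C ->
  exists2 t, 0 < t & n * t - ln (theta t) = C.
Proof.
move=> n0 C0; pose g v := n * (2 * sinh v) - v : R.
have cg : continuous g.
  have dg (t : R) : is_derive t 1 g (n * (2 * cosh t) - 1).
    have ds := is_derive_sinh t; rewrite /g; apply: is_derive_eq.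
    by rewrite /GRing.scale /=; ring.
  move=> t; apply/differentiable_continuous/derivable1_diffP.
  by apply: ex_derive; exact: dg.
(* Here b >= 1 and n * b / 4 >= 1 + C; since 2 * sinh b >= b * (b / 4), this
   gives g b >= b * C >= C. *)
pose b := 4 * (1 + C) / n + 1.
have b0 : 0 < b by rewrite addr_gt0// divr_gt0// mulr_gt0// addr_gt0.
have gb : C <= g b.
  have eb : (1 + b / 2) ^+ 2 <= expR b.
    have -> : b = b / 2 + b / 2 by field.
    rewrite expRD -expr2 -splitr ler_pXn2r// ?nnegrE ?expR_ge0 ?expR_ge1Dx//.
    by rewrite addr_ge0// divr_ge0// ltW.
  have eN : expR (- b) <= 1 by rewrite -expR0 ler_expR oppr_le0 ltW.
  have sb : b * (b / 4) <= 2 * sinh b.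
    by rewrite /sinh; nra.
  have nb : n * b = 4 * (1 + C) + n by rewrite /b; field; rewrite gt_eqF.
  have b1 : 1 <= b by rewrite lerDr divr_ge0// ?mulr_ge0 ?addr_ge0// ltW.
  have : n * (b * (b / 4)) <= n * (2 * sinh b) by rewrite ler_pM2l.
  have -> : n * (b * (b / 4)) = (n * b) * b / 4 by field.
  rewrite nb /g; nra.
have g0 : g 0 = 0 by rewrite /g sinh0 !mulr0 subrr.
have [||v] := @IVT _ g 0 b C (ltW b0).
- exact: continuous_subspaceT.
- rewrite g0 min_l ?max_r ?(ltW C0) ?gb// (le_trans _ gb) ?ltW//.
rewrite in_itv /= => /andP[v0 vb] gv.
exists (2 * sinh v); last by rewrite theta_sinh// expRK.
rewrite mulr_gt0// lt_def sinh_ge0// andbT; apply/eqP => s0.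
by move: gv; rewrite /g s0 !mulr0; lra.
Qed.

(** With u = r ^+ 2, the right-hand side is the logarithm of the condition number
    of diag (r, 1 / r): the radicand is the square of (u - u^-1) / 2. *)
Lemma arsinh_condition (R : realType) (u : R) : 0 < u ->
  arsinh (Num.sqrt (1 / 4 * (u + 1 / u) ^+ 2 - 1)) = ln (Num.max u u^-1).
Proof.
move=> u0.
have -> : 1 / 4 * (u + 1 / u) ^+ 2 - 1 = ((u - u^-1) / 2) ^+ 2.
  by field; rewrite gt_eqF.
rewrite sqrtr_sqr /arsinh real_normK ?num_real//.
have -> : ((u - u^-1) / 2) ^+ 2 + 1 = ((u + u^-1) / 2) ^+ 2.
  by field; rewrite gt_eqF.
have ui : 0 < u^-1 by rewrite invr_gt0.
rewrite sqrtr_sqr [X in _ + X]ger0_norm; last by rewrite divr_ge0// ltW// addr_gt0.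
congr ln; case: (leP u u^-1) => h.
  by rewrite ler0_norm; lra.
by rewrite ger0_norm; lra.
Qed.

Lemma max_inv_ge1 (R : realType) (u : R) : 0 < u -> 1 <= Num.max u u^-1.
Proof.
move=> u0; rewrite le_max; case: (leP 1 u) => //= u1.
by rewrite invf_ge1// ltW.
Qed.

(** * Explicit flows *)

Lemma is_derive_coord (R : realType) (x : R -> 'cV[R]_2) (t : R) (D : 'cV[R]_2) i :
  is_derive t 1 x D -> is_derive t 1 (fun s => x s i 0) (D i 0).
Proof.
move=> [dx <-]; have /derivable_mxP dxi := dx.
by rewrite derive_mx// mxE; exact: derivableP.
Qed.

(** Changes of basis are constant matrices, so the coordinates of a solution in
    any basis can be differentiated one at a time. *)
Lemma is_derive_mulmx_coord (R : realType) (M : 'M[R]_2) (x : R -> 'cV[R]_2)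
    (t : R) (D : 'cV[R]_2) i :
  is_derive t 1 x D ->
  is_derive t 1 (fun s => (M *m x s) i 0) ((M *m D) i 0).
Proof.
move=> dx; have d0 := is_derive_coord 0 dx; have d1 := is_derive_coord 1 dx.
under eq_fun do rewrite mulmx2E.
by rewrite mulmx2E; apply: is_deriveD.
Qed.

Lemma within_continuousD (R : realType) (A : set R) (f g : R -> R) :
  {within A, continuous f} -> {within A, continuous g} ->
  {within A, continuous (fun s => f s + g s)}.
Proof.
move=> cf cg t.
exact: (@continuousD _ _ _ (f : subspace A -> R) g t (cf t) (cg t)).
Qed.

Lemma within_continuousM (R : realType) (A : set R) (f g : R -> R) :
  {within A, continuous f} -> {within A, continuous g} ->
  {within A, continuous (fun s => f s * g s)}.
Proof.
move=> cf cg t.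
exact: (@continuousM _ _ (f : subspace A -> R) g t (cf t) (cg t)).
Qed.

Lemma within_continuous_mulmx_coord (R : realType) (A : set R) (M : 'M[R]_2)
    (x : R -> 'cV[R]_2) i :
  {within A, continuous x} -> {within A, continuous (fun s => (M *m x s) i 0)}.
Proof.
move=> cx.
have cxj j : {within A, continuous (fun s => x s j 0)}.
  move=> t; apply: (@continuous_comp _ _ _ (x : subspace A -> _)
    (fun y : 'cV[R]_2 => y j 0)); [exact: cx|exact: coord_continuous].
have cst (k : R) : {within A, continuous (fun=> k)} by move=> t; exact: cvg_cst.
under eq_fun do rewrite mulmx2E.
by apply: within_continuousD; apply: within_continuousM => //; exact: cst.
Qed.

Lemma derive0_constant (R : realType) (f : R -> R) (p q : R) : p <= q ->
  {within `[p, q], continuous f} ->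
  (forall t, p < t < q -> is_derive t 1 f 0) -> f q = f p.
Proof.
move=> pq cf df.
have df' t : t \in `]p, q[ -> is_derive t 1 f 0 by rewrite in_itv; exact: df.
have [c _] := MVT_segment pq df' cf.
by rewrite mul0r => /eqP; rewrite subr_eq0 => /eqP.
Qed.

Lemma is_derive_expR_affine (R : realType) (k p t : R) :
  is_derive t 1 (fun s => expR (k * (s - p))) (k * expR (k * (t - p))).
Proof.
have d : is_derive t 1 (fun s : R => k * (s - p)) k.
  by apply: is_derive_eq; rewrite /GRing.scale /=; ring.
have := @is_derive1_comp _ expR (fun s => k * (s - p)) _ _ _
  (is_derive_expR _) d.
by rewrite mulrC.
Qed.

(** The explicit exponential of a Jordan block, obtained without matrix
    exponentials: expR (n (t - p)) * y2 t and
    expR (n (t - p)) * (y1 t - (t - p) * y2 t) have zero derivative. *)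
Lemma jordan_flow (R : realType) (n : R) (y1 y2 : R -> R) (p q : R) : p <= q ->
  {within `[p, q], continuous y1} -> {within `[p, q], continuous y2} ->
  (forall t, p < t < q -> is_derive t 1 y1 (- n * y1 t + y2 t)) ->
  (forall t, p < t < q -> is_derive t 1 y2 (- n * y2 t)) ->
  y1 q = expR (- n * (q - p)) * (y1 p + (q - p) * y2 p) /\
  y2 q = expR (- n * (q - p)) * y2 p.
Proof.
move=> pq c1 c2 d1 d2.
have dE := is_derive_expR_affine n p.
have cE : {within `[p, q], continuous (fun s => expR (n * (s - p)))}.
  by apply: continuous_subspaceT; apply: continuous_is_derive.
have cL : {within `[p, q], continuous (fun s => p - s)}.
  apply: continuous_subspaceT.
  apply: (@continuous_is_derive _ _ (fun=> -1)) => t.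
  by apply: is_derive_eq; ring.
have e2 : expR (n * (q - p)) * y2 q = y2 p.
  pose F s := expR (n * (s - p)) * y2 s.
  suff : F q = F p by rewrite /F subrr mulr0 expR0 mul1r.
  apply: (derive0_constant pq).
    exact: within_continuousM.
  move=> t /d2 d2t; have dEt := dE t.
  by apply: is_derive_eq; rewrite /GRing.scale /=; ring.
have e1 : expR (n * (q - p)) * (y1 q + (p - q) * y2 q) = y1 p.
  pose F s := expR (n * (s - p)) * (y1 s + (p - s) * y2 s).
  suff : F q = F p by rewrite /F subrr mulr0 expR0 mul1r mul0r addr0.
  apply: (derive0_constant pq).
    apply: within_continuousM => //; apply: within_continuousD => //.
    exact: within_continuousM.
  move=> t pqt; have d2t := d2 _ pqt; have d1t := d1 _ pqt; have dEt := dE t.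
  by apply: is_derive_eq; rewrite /GRing.scale /=; ring.
have E0 := expR_gt0 (n * (q - p)).
rewrite mulNr expRN; split.
  by rewrite -e1 -e2; field; rewrite gt_eqF.
by rewrite -e2; field; rewrite gt_eqF.
Qed.

(** The rotation part preserves the Euclidean norm, so only the growth rate al
    is visible: expR (- 2 al (t - p)) * (z1 ^+ 2 + z2 ^+ 2) is constant. *)
Lemma focus_flow (R : realType) (al be : R) (z1 z2 : R -> R) (p q : R) : p <= q ->
  {within `[p, q], continuous z1} -> {within `[p, q], continuous z2} ->
  (forall t, p < t < q -> is_derive t 1 z1 (al * z1 t + be * z2 t)) ->
  (forall t, p < t < q -> is_derive t 1 z2 (- be * z1 t + al * z2 t)) ->
  z1 q ^+ 2 + z2 q ^+ 2 =
    expR (2 * al * (q - p)) * (z1 p ^+ 2 + z2 p ^+ 2).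
Proof.
move=> pq c1 c2 d1 d2; set k := 2 * al.
have dE := is_derive_expR_affine (- k) p.
have cE : {within `[p, q], continuous (fun s => expR (- k * (s - p)))}.
  by apply: continuous_subspaceT; apply: continuous_is_derive.
have e : expR (- k * (q - p)) * (z1 q * z1 q + z2 q * z2 q) =
         z1 p ^+ 2 + z2 p ^+ 2.
  pose F s := expR (- k * (s - p)) * (z1 s * z1 s + z2 s * z2 s).
  suff : F q = F p by rewrite /F subrr mulr0 expR0 mul1r -!expr2.
  apply: (derive0_constant pq).
    apply: within_continuousM => //.
    by apply: within_continuousD; apply: within_continuousM.
  move=> t pqt; have d2t := d2 _ pqt; have d1t := d1 _ pqt; have dEt := dE t.
  by apply: is_derive_eq; rewrite /GRing.scale /= /k; ring.
by rewrite -e mulNr expRN mulrA divff ?mul1r ?gt_eqF ?expR_gt0.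
Qed.

(** * Energies that decrease along a sequence of cycles *)

(** The least index beyond k0 with t < D k ends the wanted interval. *)
Lemma interval_locate (R : realType) (D : nat -> R) (k0 : nat) (t : R) :
  D k @[k --> \oo] --> +oo -> D k0 <= t ->
  exists2 k, (k0 <= k)%N & D k <= t <= D k.+1.
Proof.
move=> Doo Dt.
have /ex_minnP[m /andP[k0m tm] mmin] : exists m, (k0 <= m)%N && (t < D m).
  have /cvgryPgt/(_ t)[N _ tN] := Doo.
  by exists (maxn k0 N); rewrite leq_maxl tN//= leq_maxr.
case: m => [|m] in k0m tm mmin *.
  by move: k0m tm; rewrite leqn0 => /eqP <-; rewrite ltNge Dt.
have k0m' : (k0 <= m)%N.
  rewrite leqNgt; apply/negP => mk0.
  have km : k0 = m.+1 by apply/eqP; rewrite eqn_leq k0m.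
  by move: tm; rewrite -km ltNge Dt.
exists m => //; rewrite (ltW tm) andbT leNgt; apply/negP => tDm.
by have := mmin m; rewrite k0m' tDm ltnn => /(_ isT).
Qed.

Lemma cycle_decay (R : realType) (D e : nat -> R) (V : R -> R) :
  (forall k, V (D k.+1) <= expR (- e k) * V (D k)) ->
  forall k, V (D k) <= expR (- series e k) * V (D 0%N).
Proof.
move=> VD; elim=> [|k IH].
  by rewrite seriesEnat /= big_geq// oppr0 expR0 mul1r.
rewrite (le_trans (VD k))// seriesSr opprD addrC expRD -mulrA.
by apply: ler_wpM2l => //; exact: expR_ge0.
Qed.

Lemma cycle_bounded (R : realType) (D e : nat -> R) (V : R -> R) (K : R) :
  D 0%N = 0 -> D k @[k --> \oo] --> +oo -> (forall k, 0 <= e k) ->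
  0 <= K -> (forall t, 0 <= V t) ->
  (forall k, V (D k.+1) <= expR (- e k) * V (D k)) ->
  (forall k t, D k <= t <= D k.+1 -> V t <= K * V (D k)) ->
  forall t, 0 <= t -> V t <= K * V 0.
Proof.
move=> D0 Doo e0 K0 V0 VD VK t t0.
have [|k _ Dk] := @interval_locate _ D 0 t Doo; first by rewrite D0.
apply: le_trans (VK _ _ Dk) _; apply: ler_wpM2l => //.
rewrite (le_trans (cycle_decay VD k))// D0 -[leRHS]mul1r; apply: ler_wpM2r => //.
by rewrite -expR0 ler_expR oppr_le0 seriesEnat sumr_ge0.
Qed.

(** The partial sums of e are nondecreasing, so they converge or tend to +oo.
    Convergence would force e to tend to 0, hence the factors expR (- series e k)
    tend to 0. *)
Lemma cycle_cvg0 (R : realType) (D e : nat -> R) (V : R -> R) (K : R) :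
  D 0%N = 0 -> D k @[k --> \oo] --> +oo -> (forall k, 0 <= e k) ->
  0 <= K -> (forall t, 0 <= V t) ->
  (forall k, V (D k.+1) <= expR (- e k) * V (D k)) ->
  (forall k t, D k <= t <= D k.+1 -> V t <= K * V (D k)) ->
  ~ (e @ \oo --> 0) ->
  V t @[t --> +oo] --> 0.
Proof.
move=> D0 Doo e0 K0 V0 VD VK eN0.
have soo : series e @ \oo --> +oo.
  apply: nondecreasing_dvgn_lt => [|/cvg_series_cvg_0//].
  apply/nondecreasing_seqP => k.
  by rewrite seriesSr lerDl.
apply/cvgrPdist_lt => eps eps0.
have [k0 _ hk0] : \forall k \near \oo, K * V 0 < eps * expR (series e k).
  have /cvgryPgt/(_ (K * V 0 / eps)) := soo.
  apply: filterS => k.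
  rewrite ltr_pdivrMr// [X in _ < X]mulrC => /lt_le_trans; apply.
  by rewrite ler_pM2l// (le_trans _ (expR_ge1Dx _))// lerDr.
exists (D k0); split; first exact: num_real.
move=> t /ltW Dt; have [k k0k Dk] := interval_locate Doo Dt.
have Vt := VK _ _ Dk.
rewrite sub0r normrN ger0_norm//; apply: le_lt_trans Vt _.
apply: (@le_lt_trans _ _ (K * (expR (- series e k) * V 0))).
  by apply: ler_wpM2l => //; rewrite -D0; exact: cycle_decay VD k.
by rewrite mulrCA mulrC expRN ltr_pdivrMr ?expR_gt0// hk0.
Qed.

(** * One cycle of the switched system *)

Lemma switching_modes (R : realType) (sigma : R -> mode) (d : nat -> R) :
  switching_times sigma d -> sigma 0 = Mode1 ->
  forall k, sigma (d k.*2) = Mode1 /\ sigma (d k.*2.+1) = Mode2.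
Proof.
move=> [d0 _ _ _ dN] s0.
have nxt1 j : sigma (d j) = Mode1 -> sigma (d j.+1) = Mode2.
  by move=> sj; have := dN j; rewrite sj; case: (sigma (d j.+1)).
have nxt2 j : sigma (d j) = Mode2 -> sigma (d j.+1) = Mode1.
  by move=> sj; have := dN j; rewrite sj; case: (sigma (d j.+1)).
elim=> [|k [_ IH]]; first by rewrite double0; split; [|apply: nxt1]; rewrite d0.
by rewrite doubleS; split; [|apply: nxt1]; exact: nxt2.
Qed.

Lemma switching_times_ge0 (R : realType) (sigma : R -> mode) (d : nat -> R) :
  switching_times sigma d -> forall k, 0 <= d k.
Proof.
move=> [d0 dS _ _ _]; elim=> [|k IH]; first by rewrite d0.
exact: le_trans IH (ltW (dS k)).
Qed.

(** Inside a phase sigma is locally constant, so the differential equation holds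
    at every interior time; continuity carries it to the endpoints. *)
Lemma solution_phase (R : realType) (A1 A2 : 'M[R]_2) (sigma : R -> mode)
    (d : nat -> R) (x : R -> 'cV[R]_2) (k : nat) (q : R) :
  switching_times sigma d -> solution A1 A2 sigma x -> d k <= q <= d k.+1 ->
  {within `[d k, q], continuous x} /\
  forall s, d k < s < q ->
    is_derive s 1 x (subsystem A1 A2 (sigma (d k)) *m x s).
Proof.
move=> sd [cx dx] /andP[kq qk]; have dk0 := switching_times_ge0 sd k.
have [_ _ _ sc _] := sd; split.
  apply: (continuous_subspaceW _ cx) => s /=.
  by rewrite !in_itv /= andbT => /andP[/(le_trans dk0)].
move=> s /andP[ks sq].
have sE u : d k < u < q -> sigma u = sigma (d k).
  by move=> /andP[ku uq]; rewrite (sc k)// ltW//= (lt_le_trans uq).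
rewrite -(sE s) ?ks//; apply: dx; first exact: le_lt_trans ks.
have : \forall u \near s, u \in `]d k, q[.
  by apply: near_in_itvoo; rewrite in_itv /= ks.
apply: filterS => u; rewrite in_itv /= => uI.
by rewrite !sE ?ks.
Qed.

Lemma mode2_phase (R : realType) (al be : R) (P2 : 'M[R]_2)
    (x : R -> 'cV[R]_2) (p q : R) :
  P2 \in unitmx -> p <= q -> {within `[p, q], continuous x} ->
  (forall s, p < s < q ->
    is_derive s 1 x (P2 *m mx2 al be (- be) al *m invmx P2 *m x s)) ->
  enorm (invmx P2 *m x q) ^+ 2 =
    expR (2 * al * (q - p)) * enorm (invmx P2 *m x p) ^+ 2.
Proof.
move=> uP pq cx dx; rewrite !enormE.
have dz i s : p < s < q -> is_derive s 1 (fun s => (invmx P2 *m x s) i 0)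
    ((mx2 al be (- be) al *m (invmx P2 *m x s)) i 0).
  move=> /dx /(is_derive_mulmx_coord (invmx P2) i).
  by rewrite !mulmxA mulVmx// mul1mx.
apply: (@focus_flow _ al be (fun s => (invmx P2 *m x s) 0 0)
  (fun s => (invmx P2 *m x s) 1 0)) => //.
- exact: within_continuous_mulmx_coord.
- exact: within_continuous_mulmx_coord.
- by move=> s /(dz 0); rewrite [X in is_derive _ _ _ X]mulmx2E !mx2E.
- by move=> s /(dz 1); rewrite [X in is_derive _ _ _ X]mulmx2E !mx2E.
Qed.

(** The basis P1 is determined only up to matrices that commute with the Jordan
    block.  Shearing it by (a b + c d) / u, with u = a ^+ 2 + c ^+ 2, makes the
    columns of the transition matrix orthogonal, of lengths sqrt u and
    1 / sqrt u.  Passing from the basis P2 to the sheared basis and back then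
    costs exactly its condition number max (u, 1 / u), which depends on a and c
    alone, and the flow between contributes expR (- n s) * theta s. *)
Lemma mode1_phase (R : realType) (n a b c d : R) (P1 P2 : 'M[R]_2)
    (x : R -> 'cV[R]_2) (p q : R) :
  P1 \in unitmx -> P2 \in unitmx -> invmx P2 *m P1 = mx2 a b c d ->
  (a * d - b * c) ^+ 2 = 1 ->
  p <= q -> {within `[p, q], continuous x} ->
  (forall s, p < s < q ->
    is_derive s 1 x (P1 *m mx2 (- n) 1 0 (- n) *m invmx P1 *m x s)) ->
  enorm (invmx P2 *m x q) ^+ 2 <=
    (Num.max (a ^+ 2 + c ^+ 2) (a ^+ 2 + c ^+ 2)^-1 *
     (expR (- n * (q - p)) * theta (q - p))) ^+ 2 *
    enorm (invmx P2 *m x p) ^+ 2.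
Proof.
move=> uP1 uP2 ME det1 pq cx dx.
have dy i s : p < s < q -> is_derive s 1 (fun s => (invmx P1 *m x s) i 0)
    ((mx2 (- n) 1 0 (- n) *m (invmx P1 *m x s)) i 0).
  move=> /dx /(is_derive_mulmx_coord (invmx P1) i).
  by rewrite !mulmxA mulVmx// mul1mx.
have [] := @jordan_flow _ n (fun s => (invmx P1 *m x s) 0 0)
  (fun s => (invmx P1 *m x s) 1 0) p q pq.
- exact: within_continuous_mulmx_coord.
- exact: within_continuous_mulmx_coord.
- by move=> s /(dy 0); rewrite [X in is_derive _ _ _ X]mulmx2E !mx2E mul1r.
- by move=> s /(dy 1); rewrite [X in is_derive _ _ _ X]mulmx2E !mx2E mul0r add0r.
set E := expR _; set s := q - p; set u := a ^+ 2 + c ^+ 2; set mu := Num.max _ _.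
have u0 : 0 < u := col_norm_gt0 det1.
have s0 : 0 <= s by rewrite subr_ge0.
(* Completing the square; the coefficient of the second square is
   (a * d - b * c) ^+ 2 / u. *)
have VE t : enorm (invmx P2 *m x t) ^+ 2 =
    u * ((invmx P1 *m x t) 0 0 +
         (a * b + c * d) / u * (invmx P1 *m x t) 1 0) ^+ 2 +
    u^-1 * (invmx P1 *m x t) 1 0 ^+ 2.
  have -> : invmx P2 *m x t = mx2 a b c d *m (invmx P1 *m x t).
    by rewrite -ME !mulmxA mulmxK.
  set y := invmx P1 *m x t; rewrite enormE !mulmx2E !mx2E.
  rewrite -[in X in _ = _ + X * _](mul1r u^-1) -{1}det1 /u; field.
  by rewrite gt_eqF.
rewrite !VE => -> ->.
(* The shear y1 |-> y1 + kap * y2 commutes with the flow, so w obeys it too. *)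
set w2 := (invmx P1 *m x p) 1 0; set y1 := (invmx P1 *m x p) 0 0.
set kap := (a * b + c * d) / u; set w1 := y1 + kap * w2.
have -> : E * (y1 + s * w2) + kap * (E * w2) = E * (w1 + s * w2).
  by rewrite /w1; ring.
have muu : u <= mu by rewrite le_max lexx.
have mui : u^-1 <= mu by rewrite le_max lexx orbT.
have mu0 : 0 < mu := lt_le_trans u0 muu.
have h1 : 1 <= mu * u by rewrite -ler_pdivrMr// mul1r.
have h2 : 1 <= mu * u^-1 by rewrite ler_pdivlMr// mul1r.
have q1 := sqr_ge0 w1; have q2 := sqr_ge0 w2.
apply: (@le_trans _ _ (mu * (E ^+ 2 * ((w1 + s * w2) ^+ 2 + w2 ^+ 2)))).
  rewrite !exprMn mulrDr (mulrDr mu).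
  by apply: lerD; apply: ler_wpM2r; rewrite // mulr_ge0// sqr_ge0.
apply: (@le_trans _ _ (mu * (E ^+ 2 * (theta s ^+ 2 * (w1 ^+ 2 + w2 ^+ 2))))).
  apply: ler_wpM2l; first exact: ltW.
  by apply: ler_wpM2l; [exact: sqr_ge0|exact: shear_theta_le].
rewrite (_ : (_ * (_ * _)) ^+ 2 * _ = mu * (E ^+ 2 * (theta s ^+ 2 *
  ((mu * u) * w1 ^+ 2 + (mu * u^-1) * w2 ^+ 2)))); last by ring.
apply: ler_wpM2l; first exact: ltW.
do 2![apply: ler_wpM2l; first exact: sqr_ge0].
by apply: lerD; rewrite -[leLHS]mul1r; apply: ler_wpM2r.
Qed.

(** Over a cycle, the logarithm of the energy in the basis P2 changes by at most
    2 (ln mu + ln (theta t) - n1 t + alpha2 s), which the lower bound on the gain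
    makes at most - 2 (r (t - tau) + alpha2 (eta - s)).
    Inside a cycle the growth is bounded because theta t <= 1 + t while the
    second phase lasts at most eta. *)
Lemma dwell_cycle (R : realType) (n1 alpha2 beta2 : R)
    (A1 A2 P1 P2 : 'M[R]_2) (a b c d : R) (eta tau r : R)
    (sigma : R -> mode) (dt : nat -> R) (x : R -> 'cV[R]_2) :
  let mu := Num.max (a ^+ 2 + c ^+ 2) (a ^+ 2 + c ^+ 2)^-1 in
  let V t := enorm (invmx P2 *m x t) ^+ 2 in
  0 < n1 -> 0 < alpha2 -> 0 < eta -> 0 < tau -> 0 < mu -> 0 < r ->
  P1 \in unitmx -> P2 \in unitmx ->
  A1 = P1 *m mx2 (- n1) 1 0 (- n1) *m invmx P1 ->
  A2 = P2 *m mx2 alpha2 beta2 (- beta2) alpha2 *m invmx P2 ->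
  invmx P2 *m P1 = mx2 a b c d -> (a * d - b * c) ^+ 2 = 1 ->
  (forall t, tau <= t ->
     alpha2 * eta + ln mu + r * (t - tau) <= n1 * t - ln (theta t)) ->
  dwell_switching tau eta sigma dt -> solution A1 A2 sigma x ->
  forall k,
    V (dt k.*2.+2) <=
      expR (- (2 * (r * (stay1 dt k - tau) + alpha2 * (eta - stay2 dt k)))) *
      V (dt k.*2) /\
    (forall t, dt k.*2 <= t <= dt k.*2.+2 ->
      V t <= expR (2 * alpha2 * eta) * (mu * (1 + n1^-1)) ^+ 2 * V (dt k.*2)).
Proof.
move=> mu V n0 al0 eta0 tau0 mu0 r0 uP1 uP2 A1E A2E ME det1 gain.
move=> [sd s0 dwell] sol k.
have [s1 s2] := switching_modes sd s0 k.
have [_ dS _ _ _] := sd.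
have V0 t : 0 <= V t := sqr_ge0 _.
have ph1 t : dt k.*2 <= t <= dt k.*2.+1 -> V t <=
    (mu * (expR (- n1 * (t - dt k.*2)) * theta (t - dt k.*2))) ^+ 2 * V (dt k.*2).
  move=> tI; have [cx] := solution_phase sd sol tI; rewrite s1 /= A1E => dx.
  by apply: mode1_phase ME det1 _ cx dx => //; case/andP: tI.
have ph2 t : dt k.*2.+1 <= t <= dt k.*2.+2 -> V t =
    expR (2 * alpha2 * (t - dt k.*2.+1)) * V (dt k.*2.+1).
  move=> tI; have [cx] := solution_phase sd sol tI; rewrite s2 /= A2E => dx.
  by apply: mode2_phase uP2 _ cx dx => //; case/andP: tI.
have [tk sk] := dwell k.
have t0 : 0 <= stay1 dt k by rewrite (le_trans (ltW tau0)).
have th0 := theta_gt0 t0.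
have V1 : V (dt k.*2.+1) <=
    expR (2 * (ln mu - (n1 * stay1 dt k - ln (theta (stay1 dt k))))) * V (dt k.*2).
  apply: le_trans (ph1 _ _) _; first by rewrite lexx ltW.
  apply: ler_wpM2r => //; rewrite -/(stay1 dt k).
  set y := ln mu + (- n1 * stay1 dt k + ln (theta (stay1 dt k))).
  rewrite (_ : 2 * _ = y + y); last by rewrite /y; ring.
  by rewrite expRD -expr2 /y !expRD !lnK.
split.
  rewrite ph2; last by rewrite lexx andbT ltW.
  rewrite -/(stay2 dt k).
  apply: (le_trans (ler_wpM2l (expR_ge0 _) V1)).
  rewrite mulrA -expRD; apply: ler_wpM2r => //; rewrite ler_expR.
  have := gain _ tk; lra.
have ph1K t : dt k.*2 <= t <= dt k.*2.+1 ->
    V t <= (mu * (1 + n1^-1)) ^+ 2 * V (dt k.*2).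
  move=> tI; apply: le_trans (ph1 _ tI) _; apply: ler_wpM2r => //.
  case/andP: tI => kt _.
  have dt0 : 0 <= t - dt k.*2 by rewrite subr_ge0.
  have thp := ltW (theta_gt0 dt0).
  have mu0' := ltW mu0; have n0' := ltW n0.
  apply: lerXn2r;
    rewrite ?nnegrE ?mulr_ge0 ?addr_ge0 ?invr_ge0 ?expR_ge0//.
  rewrite ler_pM2l// mulNr expRN mulrC ler_pdivrMr ?expR_gt0//.
  apply: le_trans (theta_le dt0) _.
  apply: (@le_trans _ _ ((1 + n1^-1) * (1 + n1 * (t - dt k.*2)))).
    rewrite -subr_ge0 (_ : _ - _ = n1^-1 + n1 * (t - dt k.*2)); last first.
      by field; rewrite gt_eqF.
    by rewrite addr_ge0 ?invr_ge0 ?mulr_ge0 // ltW.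
  by apply: ler_wpM2l; [rewrite addr_ge0 ?invr_ge0// ltW|exact: expR_ge1Dx].
have K0 : 0 <= (mu * (1 + n1^-1)) ^+ 2 * V (dt k.*2) by rewrite mulr_ge0// sqr_ge0.
move=> t /andP[kt tk2]; rewrite -mulrA; have [t1|t1] := leP t (dt k.*2.+1).
  apply: le_trans (ph1K t _) _; first by rewrite kt.
  by rewrite ler_peMl// -expR0 ler_expR !mulr_ge0// ltW.
rewrite ph2; last by rewrite (ltW t1).
have V1K : V (dt k.*2.+1) <= (mu * (1 + n1^-1)) ^+ 2 * V (dt k.*2).
  by apply: ph1K; rewrite lexx ltW.
apply: le_trans (ler_wpM2l (expR_ge0 _) V1K) _; apply: ler_wpM2r => //.
rewrite ler_expR ler_pM2l ?mulr_gt0//; apply: le_trans sk.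
by rewrite lerD2r.
Qed.

(** Both terms are nonnegative, so each of them is at most the sum. *)
Lemma weighted_excess_cvg (R : realType) (r al tau eta : R) (t s : nat -> R) :
  0 < r -> 0 < al -> (forall k, tau <= t k /\ s k <= eta) ->
  2 * (r * (t k - tau) + al * (eta - s k)) @[k --> \oo] --> 0 ->
  (t k, s k) @[k --> \oo] --> (tau, eta).
Proof.
move=> r0 al0 ts e0.
have ct : t k @[k --> \oo] --> tau.
  apply/cvgrPdist_lt => eps eps0.
  have er : 0 < 2 * (r * eps) by rewrite !mulr_gt0.
  move/cvgrPdist_lt: e0 => /(_ _ er); apply: filterS => k.
  have [tk sk] := ts k.
  rewrite sub0r normrN distrC !ger0_norm ?subr_ge0//; last first.
    by rewrite mulr_ge0// addr_ge0// mulr_ge0 ?subr_ge0// ltW.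
  rewrite ltr_pM2l// => h; rewrite -(ltr_pM2l r0); apply: le_lt_trans h.
  by rewrite lerDl mulr_ge0 ?subr_ge0// ltW.
have cs : s k @[k --> \oo] --> eta.
  apply/cvgrPdist_lt => eps eps0.
  have er : 0 < 2 * (al * eps) by rewrite !mulr_gt0.
  move/cvgrPdist_lt: e0 => /(_ _ er); apply: filterS => k.
  have [tk sk] := ts k.
  rewrite sub0r normrN !ger0_norm ?subr_ge0//; last first.
    by rewrite mulr_ge0// addr_ge0// mulr_ge0 ?subr_ge0// ltW.
  rewrite ltr_pM2l// => h; rewrite -(ltr_pM2l al0); apply: le_lt_trans h.
  by rewrite lerDr mulr_ge0 ?subr_ge0// ltW.
exact: cvg_pair ct cs.
Qed.

Lemma even_subseq_dvg (R : realType) (d : nat -> R) :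
  d k @[k --> \oo] --> +oo -> d k.*2 @[k --> \oo] --> +oo.
Proof.
move=> doo; apply/cvgryPgt => A.
have /cvgryPgt/(_ A)[N _ dN] := doo.
exists N => // k /= Nk; apply: dN => /=.
by rewrite (leq_trans Nk)// -addnn leq_addr.
Qed.

(** * Stability *)

Lemma stable_of_energy_bound (R : realType) (A1 A2 P : 'M[R]_2)
    (sigma : R -> mode) (K : R) : P \in unitmx -> 0 < K ->
  (forall x, solution A1 A2 sigma x -> forall t, 0 <= t ->
    enorm (invmx P *m x t) ^+ 2 <= K * enorm (invmx P *m x 0) ^+ 2) ->
  stable A1 A2 sigma.
Proof.
move=> uP K0 hK eps eps0.
have [C C0 hC] := enorm_le_energy uP.
have [C' C'0 hC'] := mulmx_enorm_le (invmx P).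
have L0 : 0 < C * (K * C') by rewrite !mulr_gt0.
exists (eps / Num.sqrt (C * (K * C'))); first by rewrite divr_gt0// sqrtr_gt0.
move=> x sx x0 t /ltW t0.
rewrite -(@ltr_pXn2r _ 2)// ?nnegrE ?enorm_ge0 ?(ltW eps0)//.
apply: (@le_lt_trans _ _ (C * (K * C') * enorm (x 0) ^+ 2)).
  apply: (le_trans (hC _)); rewrite -!mulrA ler_pM2l//.
  by apply: (le_trans (hK _ sx _ t0)); rewrite ler_pM2l.
rewrite mulrC -ltr_pdivlMr// -(sqr_sqrtr (ltW L0)) -expr_div_n.
by rewrite ltr_pXn2r// ?nnegrE ?enorm_ge0// divr_ge0 ?sqrtr_ge0// ltW.
Qed.

Lemma enorm_cvg0 (R : realType) (P : 'M[R]_2) (x : R -> 'cV[R]_2) :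
  P \in unitmx -> enorm (invmx P *m x t) ^+ 2 @[t --> +oo] --> 0 ->
  enorm (x t) @[t --> +oo] --> 0.
Proof.
move=> uP V0; have [C C0 hC] := enorm_le_energy uP.
apply/cvgrPdist_lt => eps eps0.
have e0 : 0 < eps ^+ 2 / C by rewrite divr_gt0// exprn_gt0.
move/cvgrPdist_lt: V0 => /(_ _ e0); apply: filterS => t.
rewrite !sub0r !normrN !ger0_norm ?enorm_ge0 ?sqr_ge0//.
rewrite ltr_pdivlMr// mulrC => h.
rewrite -(@ltr_pXn2r _ 2)// ?nnegrE ?enorm_ge0 ?(ltW eps0)//.
exact: le_lt_trans (hC _) h.
Qed.

Theorem theorem8p1 (R : realType) (n1 alpha2 beta2 : R)
    (A1 A2 P1 P2 : 'M[R]_2) (a b c d : R) (eta : R)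
    (n1_gt0 : 0 < n1) (alpha2_gt0 : 0 < alpha2) (beta2_neq0 : beta2 <> 0)
    (P1_unit : P1 \in unitmx) (P2_unit : P2 \in unitmx)
    (A1E : A1 = P1 *m mx2 (- n1) 1 0 (- n1) *m invmx P1)
    (A2E : A2 = P2 *m mx2 alpha2 beta2 (- beta2) alpha2 *m invmx P2)
    (ME : invmx P2 *m P1 = mx2 a b c d)
    (detM : \det (mx2 a b c d) = 1 \/ \det (mx2 a b c d) = -1)
    (eta_gt0 : 0 < eta) :
  exists tau : R,
    unique (fun t : R => 0 < t /\
      n1 * t - ln (theta t) =
        alpha2 * eta +
        arsinh (Num.sqrt
          (1 / 4 * (a ^+ 2 + c ^+ 2 + 1 / (a ^+ 2 + c ^+ 2)) ^+ 2 - 1))) tau /\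
    (forall sigma : R -> mode, signals tau eta sigma -> stable A1 A2 sigma) /\
    (forall sigma : R -> mode, signals' tau eta sigma ->
       asymptotically_stable A1 A2 sigma).
Proof.
have det1 : (a * d - b * c) ^+ 2 = 1.
  by rewrite -det_mx2; case: detM => ->; rewrite ?sqrrN expr1n.
have u0 := col_norm_gt0 det1.
rewrite arsinh_condition//; set mu := Num.max _ _.
have mu1 : 1 <= mu := max_inv_ge1 u0.
have mu0 : 0 < mu := lt_le_trans ltr01 mu1.
have C0 : 0 < alpha2 * eta + ln mu by rewrite ltr_wpDr ?ln_ge0// mulr_gt0.
have [tau tau0 tauE] := dwell_gain_surjective n1_gt0 C0.
have [r r0] := dwell_gain_growth tau0 (eq_ind_r (fun z => 0 < z) C0 tauE).
rewrite tauE => gain; exists tau.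
pose K := expR (2 * alpha2 * eta) * (mu * (1 + n1^-1)) ^+ 2.
have K0 : 0 < K.
  by rewrite mulr_gt0 ?expR_gt0// exprn_gt0// mulr_gt0// addr_gt0// invr_gt0.
pose e dt k := 2 * (r * (stay1 dt k - tau) + alpha2 * (eta - stay2 dt k)).
have cyc sigma dt x (h : dwell_switching tau eta sigma dt)
    (sx : solution A1 A2 sigma x) :=
  dwell_cycle n1_gt0 alpha2_gt0 eta_gt0 tau0 mu0 r0 P1_unit P2_unit A1E A2E ME
    det1 gain h sx.
have e0 sigma dt k : dwell_switching tau eta sigma dt -> 0 <= e dt k.
  move=> [_ _ /(_ k)[tk sk]].
  by rewrite mulr_ge0// addr_ge0// mulr_ge0 ?subr_ge0// ltW.
have st sigma : signals tau eta sigma -> stable A1 A2 sigma.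
  move=> [dt dw]; apply: (stable_of_energy_bound P2_unit K0) => x sx.
  have [[d0 _ doo _ _] _ _] := dw; have cx := cyc sigma dt x dw sx.
  apply: (@cycle_bounded _ (fun k => dt k.*2) (e dt)) => //.
  - exact: even_subseq_dvg.
  - by move=> k; exact: e0 dw.
  - exact: ltW.
  - by move=> t; exact: sqr_ge0.
  - by move=> k; exact: (cx k).1.
  - by move=> k; exact: (cx k).2.
split; last split => //.
  split => // t [t0 tE]; apply: (dwell_gain_inj tau0 t0 _ (etrans tauE _)).
    by rewrite tauE.
  by rewrite tE.
move=> sigma [dt [dw ncv]]; split; first by apply: st; exists dt.
move=> x sx; apply: (enorm_cvg0 P2_unit).
have [[d0 _ doo _ _] _ ts] := dw; have cx := cyc sigma dt x dw sx.
apply: (@cycle_cvg0 _ (fun k => dt k.*2) (e dt) _ K) => //.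
- exact: even_subseq_dvg.
- by move=> k; exact: e0 dw.
- exact: ltW.
- by move=> t; exact: sqr_ge0.
- by move=> k; exact: (cx k).1.
- by move=> k; exact: (cx k).2.
- by move=> /(weighted_excess_cvg r0 alpha2_gt0 ts).
Qed.
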